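(* A function $\varphi\in L^1(\mathbb{R})$ satisfies $$\int_{-\infty}^{\infty}e^{|t|s}|\varphi(t)|\,dt<\infty\quad\text{for all }s>0$$ if and only if the function $p(s)=-\log\int_{|t|\ge s}|\varphi(t)|\,dt$ ($s\ge0$) satisfies $$\lim_{s\to\infty}\frac{p(s)}{s}=\infty .$$ In this case $\Phi(z)=\int_{-\infty}^{\infty}e^{zt}\varphi(t)\,dt$, $z\in\mathbb{C}$, is an entire function.
   Context: By convention $p(s)=+\infty$ when $\int_{|t|\ge s}|\varphi(t)|\,dt=0$. *)

(* Defs.v *)
From mathcomp Require Import all_boot all_order all_algebra.
From mathcomp Require Import complex.
From mathcomp Require Import all_classical all_reals all_analysis.

Set Implicit Arguments.
Unset Strict Implicit.
Unset Printing Implicit Defensive.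

Import Order.TTheory GRing.Theory Num.Theory.
Import numFieldNormedType.Exports.

Local Open Scope classical_set_scope.
Local Open Scope ring_scope.
Local Open Scope complex_scope.

(* The modulus as an element of R; the norm [`|z|] of R[i] has type R[i]. *)
Definition cmod (R : realType) (z : R[i]) : R := ComplexField.Normc.normc z.

Definition cexp (R : realType) (z : R[i]) : R[i] :=
  (expR (complex.Re z))%:C
  * (cos (complex.Im z) +i* sin (complex.Im z)).

(* Membership of [f] in L^1(R), as a Borel measurable representative. *)
Definition cL1 (R : realType) (f : R -> R[i]) : Prop :=
  (@lebesgue_measure R).-integrable setT
    (fun t => (complex.Re (f t))%:E) /\
  (@lebesgue_measure R).-integrable setT
    (fun t => (complex.Im (f t))%:E).

(* Meaningful only when [cL1 f] holds. *)
Definition cintegral (R : realType) (f : R -> R[i]) : R[i] :=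
  Rintegral (@lebesgue_measure R) setT (fun t => complex.Re (f t))
  +i* Rintegral (@lebesgue_measure R) setT (fun t => complex.Im (f t)).

(* Complex differentiability: R[i]^o is R[i] as a normed space over itself, so
   the increments in [derivable] range over R[i]. *)
Definition entire (R : realType) (f : R[i] -> R[i]) : Prop :=
  forall z : R[i], derivable (f : R[i]^o -> R[i]^o) z 1.

(* As [lne 0 = -oo], the value is +oo when the tail integral vanishes. *)
Definition tail_exponent (R : realType) (phi : R -> R[i]) (s : R) : \bar R :=
  (- lne (\int[@lebesgue_measure R]_(t in [set t : R | (s <= `|t|)%R])
            (cmod (phi t))%:E))%E.

Definition laplace_kernel (R : realType) (phi : R -> R[i]) (z : R[i]) (t : R)
    : R[i] :=
  cexp (z * t%:C) * phi t.

Definition laplace (R : realType) (phi : R -> R[i]) (z : R[i]) : R[i] :=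
  cintegral (laplace_kernel phi z).

(* Main.v *)
Require Import Defs.
From mathcomp Require Import all_boot all_order all_algebra.
From mathcomp Require Import complex.
From mathcomp Require Import all_classical all_reals all_analysis.
From mathcomp Require Import measurable_realfun.
From mathcomp Require Import ring lra.

Import Order.TTheory GRing.Theory Num.Theory.
Import numFieldNormedType.Exports.

Local Open Scope classical_set_scope.
Local Open Scope ring_scope.
Local Open Scope complex_scope.

Set Implicit Arguments.
Unset Strict Implicit.
Unset Printing Implicit Defensive.

(** Write T(s) for the integral of |phi| over |t| >= s. The growth condition on
    the tail exponent says exactly that, for every rate a, eventually
    T(s) <= e^(-as) ([tail_exponent_cvgyP]); this covers the case T(s) = 0.

    If the exponential moments are finite, Chernoff's inequality
    e^(bs) T(s) <= M_b, with M_b the moment of order b ([chernoff_tail]), used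
    with b >= a + 1, leaves a spare factor e^(-s) which absorbs the constant
    M_b. Conversely, cutting the line into the shells N + n <= |t| < N + n + 1
    bounds the moment of order s by e^(sN) T(0) plus a series with terms
    e^(s(N+n+1)) T(N + n); the tail bound at rate s + 1 makes that series
    geometric of ratio e^(-1) ([expR_moment_lty]).

    For the entire function no passage to the limit under the integral sign is
    used. The inequality |e^w - 1 - w| <= 4 |w|^2 e^|w|
    ([cmod_cexp_sub_affine_le]), applied with w = ht and multiplied by
    e^(zt) phi(t), bounds the first-order Taylor remainder of the integrand by
    4 |h|^2 e^((|z|+3)|t|) |phi(t)| when |h| <= 1. Integrating,
    Phi(z + h) = Phi(z) + h D + O(|h|^2), where D is the integral of
    t e^(zt) phi(t), and a quadratic remainder gives complex
    differentiability. *)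

(** * Complex numbers: modulus and integrability *)

Lemma cmod_ge0 (R : realType) (z : R[i]) : 0 <= cmod z.
Proof. by case: z => x y; rewrite /cmod/= sqrtr_ge0. Qed.

Lemma norm_Re_le_cmod (R : realType) (z : R[i]) : `|complex.Re z| <= cmod z.
Proof. by have := normc_ge_Re z; rewrite lecR. Qed.

Lemma norm_Im_le_cmod (R : realType) (z : R[i]) : `|complex.Im z| <= cmod z.
Proof.
by case: z => x y; rewrite /cmod/= -sqrtr_sqr ler_wsqrtr// lerDr sqr_ge0.
Qed.

Lemma cmod_le_ReIm (R : realType) (z : R[i]) :
  cmod z <= `|complex.Re z| + `|complex.Im z|.
Proof.
case: z => x y; rewrite /cmod/= -[leRHS]ger0_norm ?addr_ge0// -sqrtr_sqr.
rewrite ler_wsqrtr// sqrrD !real_normK ?num_real//.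
by rewrite -addrA lerD2l lerDr mulrn_wge0// mulr_ge0.
Qed.

Lemma cmodM (R : realType) (z w : R[i]) : cmod (z * w) = cmod z * cmod w.
Proof. exact: ComplexField.Normc.normcM. Qed.

Lemma cmod_real (R : realType) (x : R) : cmod x%:C = `|x|.
Proof. by rewrite /cmod/= expr0n/= addr0 sqrtr_sqr. Qed.

(** Measurability for the Borel structure of the plane, stated on the two
    coordinates because the integrals are taken coordinate by coordinate. *)
Definition cmeasurable (R : realType) (f : R -> R[i]) : Prop :=
  measurable_fun setT (fun t => complex.Re (f t)) /\
  measurable_fun setT (fun t => complex.Im (f t)).

Lemma cL1_measurable (R : realType) (f : R -> R[i]) : cL1 f -> cmeasurable f.
Proof.
by move=> [/measurable_int/measurable_EFinP ? /measurable_int/measurable_EFinP].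
Qed.

Lemma measurable_cmod (R : realType) (f : R -> R[i]) : cL1 f ->
  measurable_fun setT (fun t => cmod (f t)).
Proof.
move=> /cL1_measurable[mRe mIm].
rewrite (_ : (fun _ => _) = Num.sqrt \o
  (fun t => complex.Re (f t) ^+ 2 + complex.Im (f t) ^+ 2)); last first.
  by apply/funext => t /=; case: (f t).
apply: measurableT_comp.
  by apply: continuous_measurable_fun; exact: sqrt_continuous.
by apply: measurable_funD; apply: measurable_funX.
Qed.

Lemma cL1_cmod_lty (R : realType) (f : R -> R[i]) : cL1 f ->
  (\int[@lebesgue_measure R]_t (cmod (f t))%:E < +oo)%E.
Proof.
move=> f1; have [iRe iIm] := f1; have [mRe mIm] := cL1_measurable f1.
have : (\int[@lebesgue_measure R]_t
   (`|(complex.Re (f t))%:E| + `|(complex.Im (f t))%:E|) < +oo)%E.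
  rewrite ge0_integralD//.
  - apply: lte_add_pinfty; [by case/integrableP: iRe|by case/integrableP: iIm].
  - by apply: measurableT_comp => //; exact/measurable_EFinP.
  - by apply: measurableT_comp => //; exact/measurable_EFinP.
apply: le_lt_trans; apply: ge0_le_integral => //.
- by move=> t _; rewrite lee_fin cmod_ge0.
- by apply/measurable_EFinP; exact: measurable_cmod.
- apply: emeasurable_funD; apply: measurableT_comp => //;
    exact/measurable_EFinP.
- by move=> t _; rewrite lee_fin cmod_le_ReIm.
Qed.

Lemma cmeasurableM (R : realType) (f g : R -> R[i]) :
  cmeasurable f -> cmeasurable g -> cmeasurable (fun t => f t * g t).
Proof.
move=> [fRe fIm] [gRe gIm]; split.
  rewrite (_ : (fun _ => _) = (fun t => complex.Re (f t) * complex.Re (g t)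
    - complex.Im (f t) * complex.Im (g t))).
    by apply: measurable_funB; exact: measurable_funM.
  by apply/funext => t; case: (f t) (g t) => ? ? [].
rewrite (_ : (fun _ => _) = (fun t => complex.Re (f t) * complex.Im (g t)
    + complex.Im (f t) * complex.Re (g t))).
  by apply: measurable_funD; exact: measurable_funM.
by apply/funext => t; case: (f t) (g t) => ? ? [].
Qed.

Lemma cmeasurable_real (R : realType) : cmeasurable (fun t : R => t%:C).
Proof. by split=> /=; [exact: measurable_id|exact: measurable_cst]. Qed.

Lemma cmeasurable_cst (R : realType) (z : R[i]) : cmeasurable (fun _ : R => z).
Proof. by split; exact: measurable_cst. Qed.

Lemma cmeasurable_cexp (R : realType) (f : R -> R[i]) :
  cmeasurable f -> cmeasurable (fun t => cexp (f t)).
Proof.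
move=> [fRe fIm]; apply: cmeasurableM; split=> /=.
- exact: measurableT_comp.
- exact: measurable_cst.
- apply: measurableT_comp => //; apply: continuous_measurable_fun.
  exact: continuous_cos.
- apply: measurableT_comp => //; apply: continuous_measurable_fun.
  exact: continuous_sin.
Qed.

Lemma cL1_dominated (R : realType) (f : R -> R[i]) (g : R -> R) :
  cmeasurable f ->
  (@lebesgue_measure R).-integrable setT (fun t => (g t)%:E) ->
  (forall t, cmod (f t) <= g t) -> cL1 f.
Proof.
move=> [fRe fIm] gi fg; have fg' t : cmod (f t) <= `|g t|.
  exact: le_trans (fg t) (ler_norm _).
split; apply: le_integrable gi => //; try exact/measurable_EFinP.
- by move=> t _; rewrite lee_fin (le_trans (norm_Re_le_cmod _)).
- by move=> t _; rewrite lee_fin (le_trans (norm_Im_le_cmod _)).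
Qed.

Lemma cL1B (R : realType) (f g : R -> R[i]) : cL1 f -> cL1 g ->
  cL1 (fun t => f t - g t).
Proof.
move=> [fRe fIm] [gRe gIm]; split.
- have := integrableB measurableT fRe gRe; apply: eq_integrable => //= t _.
  by case: (f t) (g t) => ? ? [].
- have := integrableB measurableT fIm gIm; apply: eq_integrable => //= t _.
  by case: (f t) (g t) => ? ? [].
Qed.

Lemma cintegralB (R : realType) (f g : R -> R[i]) : cL1 f -> cL1 g ->
  cintegral (fun t => f t - g t) = cintegral f - cintegral g.
Proof.
move=> [fRe fIm] [gRe gIm]; rewrite /cintegral.
rewrite [RHS](_ : _ = (Rintegral (@lebesgue_measure R) setT
    (fun t => complex.Re (f t)) - Rintegral (@lebesgue_measure R) setT
    (fun t => complex.Re (g t))) +i* (Rintegral (@lebesgue_measure R) setT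
    (fun t => complex.Im (f t)) - Rintegral (@lebesgue_measure R) setT
    (fun t => complex.Im (g t))))//.
rewrite -!RintegralB//; congr (_ +i* _); apply: eq_Rintegral => t _;
  by case: (f t) (g t) => ? ? [].
Qed.

Lemma cL1Z (R : realType) (c : R[i]) (f : R -> R[i]) : cL1 f ->
  cL1 (fun t => c * f t).
Proof.
case: c => a b [fRe fIm]; split.
- have := integrableB measurableT (integrableZl measurableT a fRe)
    (integrableZl measurableT b fIm).
  by apply: eq_integrable => //= t _; case: (f t).
- have := integrableD measurableT (integrableZl measurableT a fIm)
    (integrableZl measurableT b fRe).
  by apply: eq_integrable => //= t _; case: (f t).
Qed.

Lemma cintegralZ (R : realType) (c : R[i]) (f : R -> R[i]) : cL1 f ->
  cintegral (fun t => c * f t) = c * cintegral f.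
Proof.
case: c => a b [fRe fIm]; rewrite /cintegral.
pose I (h : R -> R) := Rintegral (@lebesgue_measure R) setT h.
rewrite [RHS](_ : _ = (a * I (fun t => complex.Re (f t)) -
  b * I (fun t => complex.Im (f t))) +i* (a * I (fun t => complex.Im (f t)) +
  b * I (fun t => complex.Re (f t))))//.
have Z (k : R) (h : R -> R) :
    (@lebesgue_measure R).-integrable setT (EFin \o h) ->
    (@lebesgue_measure R).-integrable setT (EFin \o (fun t => k * h t)).
  by move=> hi; exact: (integrableZl measurableT k hi).
rewrite /I -!RintegralZl// -RintegralB//; try exact: Z.
rewrite -RintegralD//; try exact: Z.
by congr (_ +i* _); apply: eq_Rintegral => t _; case: (f t).
Qed.

(** The factor 2 comes from bounding the real and the imaginary part
    separately; it saves the rotation argument that yields the constant 1. *)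
Lemma cmod_cintegral_le (R : realType) (f : R -> R[i]) (g : R -> R) :
  cL1 f -> (@lebesgue_measure R).-integrable setT (fun t => (g t)%:E) ->
  (forall t, cmod (f t) <= g t) ->
  cmod (cintegral f) <= 2 * Rintegral (@lebesgue_measure R) setT g.
Proof.
move=> [fRe fIm] gi fg.
apply: le_trans (cmod_le_ReIm _) _; rewrite /= mulr_natl mulr2n.
have part (h : R -> R) :
    (@lebesgue_measure R).-integrable setT (fun t => (h t)%:E) ->
    (forall t, `|h t| <= g t) ->
    `|Rintegral (@lebesgue_measure R) setT h| <=
    Rintegral (@lebesgue_measure R) setT g.
  move=> hi hg; apply: le_trans (le_normr_Rintegral measurableT hi) _.
  by apply: le_Rintegral => //; exact: integrable_abse hi.
by apply: lerD; apply: part => // t; apply: le_trans (fg t);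
  [exact: norm_Re_le_cmod|exact: norm_Im_le_cmod].
Qed.

(** * Exponential moments and tails *)

Lemma measurable_abs_ge (R : realType) (s : R) :
  measurable [set t : R | s <= `|t|].
Proof.
rewrite (_ : [set _ | _] = (fun t : R => `|t|) @^-1` `[s, +oo[).
  by rewrite -[X in measurable X]setTI; apply: normr_measurable => //.
by apply/seteqP; split => t /=; rewrite in_itv/= andbT.
Qed.

Lemma measurable_expR_weight (R : realType) (w : R -> R) (s : R) :
  measurable_fun setT w ->
  measurable_fun setT (fun t : R => (expR (`|t| * s) * w t)%:E).
Proof.
move=> mw; apply/measurable_EFinP; apply: measurable_funM => //.
by apply: measurableT_comp => //; exact: measurable_funM.
Qed.

(** On |t| >= s the weight e^(a|t|) is at least e^(as). *)
Lemma chernoff_tail (R : realType) (w : R -> R) (a s : R) :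
  measurable_fun setT w -> (forall t, 0 <= w t) -> 0 <= a ->
  ((expR (a * s))%:E *
     \int[@lebesgue_measure R]_(t in [set t | (s <= `|t|)%R]) (w t)%:E
   <= \int[@lebesgue_measure R]_t (expR (`|t| * a) * w t)%:E)%E.
Proof.
move=> mw w0 a0; have mA := measurable_abs_ge s.
have mwA : measurable_fun [set t : R | s <= `|t|] (fun t => (w t)%:E).
  by apply/measurable_EFinP; exact: measurable_funTS.
rewrite -ge0_integralZl_EFin ?expR_ge0//; last first.
  by move=> t _; rewrite lee_fin.
apply: (@le_trans _ _ (\int[@lebesgue_measure R]_(t in [set t | (s <= `|t|)%R])
  (expR (`|t| * a) * w t)%:E)%E).
  apply: ge0_le_integral => //.
  - by move=> t _; rewrite -EFinM lee_fin mulr_ge0// expR_ge0.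
  - by apply: measurable_funeM.
  - apply: measurable_funTS; exact: measurable_expR_weight.
  - move=> t /= st; rewrite -EFinM lee_fin ler_wpM2r// ler_expR mulrC.
    by rewrite ler_wpM2r.
apply: ge0_subset_integral => //; first exact: measurable_expR_weight.
by move=> t _; rewrite lee_fin mulr_ge0// expR_ge0.
Qed.

(** A point with |t| < N is covered by the first term. Otherwise the single
    term of index n = floor |t| - N of the series suffices, as
    N + n <= |t| < N + n + 1. *)
Lemma expR_weight_le_series (R : realType) (w : R -> R) (s : R) (N : nat) t :
  (forall t, 0 <= w t) -> 0 <= s ->
  ((expR (`|t| * s) * w t)%:E <=
   (expR (N%:R * s))%:E * (w t)%:E +
   \sum_(n <oo) (expR ((N + n).+1%:R * s))%:E *
     ((fun t => (w t)%:E) \_ [set t : R | ((N + n)%:R <= `|t|)%R]) t)%E.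
Proof.
move=> w0 s0.
have term0 n : (0 <= (expR ((N + n).+1%:R * s))%:E *
     ((fun t => (w t)%:E) \_ [set t : R | ((N + n)%:R <= `|t|)%R]) t)%E.
  rewrite mule_ge0 ?lee_fin ?expR_ge0//.
  by apply: erestrict_ge0 => u _; rewrite lee_fin.
have [tN|Nt] := ltP `|t| N%:R.
  rewrite -[leLHS]adde0 leeD//; last exact: nneseries_ge0.
  rewrite -EFinM lee_fin ler_wpM2r// ler_expR ler_wpM2r//; exact: ltW.
have [lo hi] := andP (truncn_itv (normr_ge0 t)).
have NT : (N <= Num.truncn `|t|)%N by rewrite truncn_ge_nat.
rewrite -[leLHS]add0e leeD ?mule_ge0 ?lee_fin ?expR_ge0//.
apply: le_trans (nneseries_lim_ge (Num.truncn `|t| - N).+1 _) => //.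
rewrite big_nat_recr//= -[leLHS]add0e leeD ?sume_ge0//.
rewrite patchE subnKC// ifT; last by rewrite inE.
rewrite -EFinM lee_fin ler_wpM2r// ler_expR ler_wpM2r//; exact: ltW.
Qed.

Lemma nneseries_geometric_lty (R : realType) (c x : R) :
  0 <= c -> 0 < x -> x < 1 -> (\sum_(n <oo) (c * x ^+ n)%:E < +oo)%E.
Proof.
move=> c0 x0 x1; apply: (@le_lt_trans _ _ (c * (1 - x)^-1)%:E); last first.
  exact: ltry.
apply: lime_le.
  apply: is_cvg_nneseries => n _ _.
  by rewrite lee_fin mulr_ge0// exprn_ge0// ltW.
apply: nearW => n; rewrite sumEFin lee_fin.
by apply: geometric_le_lim => //; rewrite ger0_norm// ltW.
Qed.

(** The tail bound is asked at rate s + 1: against the growth e^(s|t|) this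
    leaves a factor e^(-1) per unit shell, hence a geometric series. The shells
    start at an integer N from which the bound holds, and the part |t| < N
    costs only e^(sN) times the integral of w. *)
Lemma expR_moment_lty (R : realType) (w : R -> R) (s : R) :
  measurable_fun setT w -> (forall t, 0 <= w t) -> 0 <= s ->
  (\int[@lebesgue_measure R]_t (w t)%:E < +oo)%E ->
  (\forall u \near +oo,
     (\int[@lebesgue_measure R]_(t in [set t | (u <= `|t|)%R]) (w t)%:E
      <= (expR (- ((s + 1) * u)))%:E)%E) ->
  (\int[@lebesgue_measure R]_t (expR (`|t| * s) * w t)%:E < +oo)%E.
Proof.
move=> mw w0 s0 wfin [M [Mreal tailM]].
have [N MN] : exists N : nat, M < N%:R.
  exists (Num.truncn `|M|).+1; apply: le_lt_trans (ler_norm _) _.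
  by have /andP[] := truncn_itv (normr_ge0 M).
pose A n := [set t : R | ((N + n)%:R <= `|t|)%R].
have mA n : measurable (A n) by exact: measurable_abs_ge.
have mw' : measurable_fun setT (fun t => (w t)%:E) by exact/measurable_EFinP.
have w0' t : setT t -> (0 <= (w t)%:E)%E by rewrite lee_fin.
have wA0 n t : (0 <= ((fun t => (w t)%:E) \_ (A n)) t)%E.
  by apply: erestrict_ge0 => u _; rewrite lee_fin.
have mwA n : measurable_fun setT ((fun t => (w t)%:E) \_ (A n)).
  by apply/(measurable_restrictT _ _).1 => //; exact: measurable_funTS.
pose f n t := ((expR ((N + n).+1%:R * s))%:E *
     ((fun t => (w t)%:E) \_ (A n)) t)%E.
have f0 n t : setT t -> (0 <= f n t)%E.
  by move=> _; apply: mule_ge0 => //; rewrite lee_fin expR_ge0.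
have mf n : measurable_fun setT (f n) by exact: measurable_funeM.
have msum : measurable_fun setT (fun t => \sum_(n <oo) f n t)%E.
  by apply: ge0_emeasurable_sum => // n t _ _; exact: f0.
have sum0 t : setT t -> (0 <= \sum_(n <oo) f n t)%E.
  by move=> _; apply: nneseries_ge0 => n _ _; exact: f0.
apply: (@le_lt_trans _ _ (\int[@lebesgue_measure R]_t
   ((expR (N%:R * s))%:E * (w t)%:E + \sum_(n <oo) f n t))%E).
  apply: ge0_le_integral => //.
  - by move=> t _; rewrite lee_fin mulr_ge0// expR_ge0.
  - exact: measurable_expR_weight.
  - by apply: emeasurable_funD => //; exact: measurable_funeM.
  - by move=> t _; exact: expR_weight_le_series.
rewrite ge0_integralD//; first last.
- exact: measurable_funeM.
- by move=> t _; apply: mule_ge0; rewrite lee_fin ?expR_ge0.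
rewrite ge0_integralZl_EFin ?expR_ge0//.
apply: lte_add_pinfty.
  by apply: lte_mul_pinfty => //; rewrite ?lee_fin ?expR_ge0.
rewrite integral_nneseries//.
(* e^(s(N+n+1)) e^(-(s+1)(N+n)) = e^(s-N) e^(-n) *)
have e1 : expR (- 1 : R) < 1 by rewrite expR_lt1 oppr_lt0.
apply: le_lt_trans
  (nneseries_geometric_lty (expR_ge0 (s - N%:R)) (expR_gt0 _) e1).
apply: lee_nneseries => n _.
  by move=> _; apply: integral_ge0 => t; exact: f0.
rewrite ge0_integralZl_EFin ?expR_ge0//; last exact: mwA.
apply: (@le_trans _ _ ((expR ((N + n).+1%:R * s))%:E *
   (expR (- ((s + 1) * (N + n)%:R)))%:E)%E).
  apply: lee_wpmul2l; first by rewrite lee_fin expR_ge0.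
  have /tailM tailN : M < (N + n)%:R.
    by apply: lt_le_trans MN _; rewrite ler_nat leq_addr.
  by rewrite integral_mkcond in tailN.
rewrite -EFinM lee_fin -expRM_natl -!expRD ler_expR -natr1 natrD.
by lra.
Qed.

(** For s > 0 the inequality a <= p(s)/s is T(s) <= e^(-as); when T(s) = 0 both
    hold, since the exponent is then infinite. *)
Lemma tail_exponent_cvgyP (R : realType) (phi : R -> R[i]) :
  (tail_exponent phi s / s%:E)%E @[s --> +oo] --> +oo%E <->
  forall a : R, \forall s \near +oo,
    (\int[@lebesgue_measure R]_(t in [set t | (s <= `|t|)%R])
       (cmod (phi t))%:E <= (expR (- (a * s)))%:E)%E.
Proof.
have key (a s : R) : 0 < s ->
    (a%:E <= tail_exponent phi s / s%:E)%E =
    (\int[@lebesgue_measure R]_(t in [set t | (s <= `|t|)%R])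
       (cmod (phi t))%:E <= (expR (- (a * s)))%:E)%E.
  move=> s0; rewrite inver gt_eqF// lee_pdivlMr// /tail_exponent.
  rewrite leeNr -EFinM -lee_expeR lneK//.
  rewrite in_itv/= leey andbT integral_ge0// => t _.
  by rewrite lee_fin cmod_ge0.
rewrite cvgeyPge; split=> h a; near=> s.
  by rewrite -key//; near: s; exact: h.
by rewrite key//; near: s; exact: h.
Unshelve. all: by end_near.
Qed.

Definition finite_exp_moments (R : realType) (phi : R -> R[i]) : Prop :=
  forall s : R, 0 < s ->
    (\int[@lebesgue_measure R]_t (expR (`|t| * s) * cmod (phi t))%:E
       < +oo)%E.

Lemma finite_exp_moments_iff (R : realType) (phi : R -> R[i]) :
  cL1 phi ->
  finite_exp_moments phi <->
  (tail_exponent phi s / s%:E)%E @[s --> +oo] --> +oo%E.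
Proof.
move=> phi1; have mw := measurable_cmod phi1.
have w0 t : 0 <= cmod (phi t) := cmod_ge0 _.
rewrite tail_exponent_cvgyP; split=> [fin a|tail s s0]; last first.
  apply: expR_moment_lty => //; first exact: ltW.
  exact: cL1_cmod_lty.
(* A positive order exceeding a by 1: the surplus e^(-s) will absorb M. *)
pose b := Num.max a 0 + 1.
have b0 : 0 < b by rewrite ltr_wpDl// le_max lexx orbT.
have ab : a + 1 <= b by rewrite lerD2r le_max lexx.
pose M :=
  fine (\int[@lebesgue_measure R]_t (expR (`|t| * b) * cmod (phi t))%:E).
near=> s.
have s0 : 0 < s by [].
have := chernoff_tail s mw w0 (ltW b0).
rewrite -[leRHS]fineK -/M; last first.
  rewrite ge0_fin_numE ?fin//; apply: integral_ge0 => t _.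
  by rewrite lee_fin mulr_ge0// expR_ge0.
rewrite muleC -lee_pdivlMr ?expR_gt0// => /le_trans; apply.
rewrite -EFinM lee_fin -expRN.
have Ms : M <= expR s.
  by apply: le_trans (expR_ge1Dx s); rewrite ler_wpDl.
apply: le_trans (ler_wpM2r (expR_ge0 _) Ms) _.
rewrite -expRD ler_expR.
have := ler_wpM2r (ltW s0) ab; lra.
Unshelve. all: by end_near.
Qed.

(** * Second-order bound for the exponential *)

(** The mean value inequality from 0, for x of either sign. Applied repeatedly,
    it raises the order of vanishing at 0 by one each time, which gives all the
    first- and second-order bounds below. *)
Lemma norm_increment_le (R : realType) (f df : R -> R) (K x : R) :
  (forall y : R, is_derive y 1 f (df y)) ->
  (forall y, `|y| <= `|x| -> `|df y| <= K) ->
  `|f x - f 0| <= K * `|x|.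
Proof.
move=> fdf dfK.
have fc : continuous f.
  by move=> y; apply/differentiable_continuous/derivable1_diffP.
have [x0|x0] := leP 0 x.
  have [c c0x ->] :=
    MVT_segment x0 (fun y _ => fdf y) (continuous_subspaceT fc).
  rewrite subr0 normrM ler_wpM2r// dfK//.
  by move: c0x; rewrite in_itv/= => /andP[? ?]; rewrite !ger0_norm.
have [c cx0 fE] :=
  MVT_segment (ltW x0) (fun y _ => fdf y) (continuous_subspaceT fc).
rewrite distrC fE sub0r normrM normrN ler_wpM2r// dfK//.
move: cx0; rewrite in_itv/= => /andP[? ?].
by rewrite (ler0_norm (ltW x0)) ler0_norm// lerN2.
Qed.

Lemma norm_cos_le1 (R : realType) (x : R) : `|cos x| <= 1.
Proof. by rewrite ler_norml cos_geN1 cos_le1. Qed.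

Lemma norm_sin_le1 (R : realType) (x : R) : `|sin x| <= 1.
Proof. by rewrite ler_norml sin_geN1 sin_le1. Qed.

Lemma norm_expR_sub1_le (R : realType) (x : R) :
  `|expR x - 1| <= expR `|x| * `|x|.
Proof.
rewrite -{1}expR0; apply: (@norm_increment_le _ expR expR) => y yx.
by rewrite ger0_norm ?expR_ge0// ler_expR (le_trans (ler_norm y)).
Qed.

Lemma norm_expR_sub_affine_le (R : realType) (x : R) :
  `|expR x - 1 - x| <= expR `|x| * `|x| ^+ 2.
Proof.
have := @norm_increment_le _ (fun y => expR y - y) (fun y => expR y - 1)
  (expR `|x| * `|x|) x.
rewrite expR0 subr0 addrAC expr2 mulrA; apply=> y yx.
apply: le_trans (norm_expR_sub1_le y) _.
by apply: ler_pM; rewrite ?expR_ge0// ler_expR.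
Qed.

Lemma norm_sin_le (R : realType) (x : R) : `|sin x| <= `|x|.
Proof.
rewrite -[sin x]subr0 -sin0 -[leRHS]mul1r.
by apply: norm_increment_le => y _; exact: norm_cos_le1.
Qed.

Lemma norm_cos_sub1_le (R : realType) (x : R) : `|cos x - 1| <= `|x| ^+ 2.
Proof.
rewrite -cos0 expr2; apply: norm_increment_le => y yx.
by rewrite normrN (le_trans (norm_sin_le y)).
Qed.

Lemma norm_cos_sub1_le_norm (R : realType) (x : R) : `|cos x - 1| <= `|x|.
Proof.
rewrite -cos0 -[leRHS]mul1r.
apply: (@norm_increment_le _ cos (fun y => - sin y)) => y _.
by rewrite normrN norm_sin_le1.
Qed.

Lemma norm_sin_sub_le (R : realType) (x : R) : `|sin x - x| <= `|x| ^+ 2.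
Proof.
have := @norm_increment_le _ (fun y => sin y - y) (fun y => cos y - 1) `|x| x.
rewrite sin0 !subr0 expr2; apply=> y yx.
by apply: le_trans (norm_cos_sub1_le_norm y) _.
Qed.

Lemma norm_le_expR (R : realType) (t : R) : `|t| <= expR `|t|.
Proof. by apply: le_trans (expR_ge1Dx _); rewrite lerDr. Qed.

Lemma cexpD (R : realType) (z w : R[i]) : cexp (z + w) = cexp z * cexp w.
Proof.
case: z w => a b [c d]; rewrite /cexp/= expRD cosD sinD.
by apply/eqP; rewrite eq_complex /=; apply/andP; split; apply/eqP; ring.
Qed.

Lemma cmod_cexp (R : realType) (z : R[i]) : cmod (cexp z) = expR (complex.Re z).
Proof.
rewrite /cexp cmodM cmod_real ger0_norm ?expR_ge0//.
by rewrite [X in _ * X]/cmod/= cos2Dsin2 sqrtr1 mulr1.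
Qed.

(** Each coordinate splits into two second-order quantities:
    e^x cos y - 1 - x = (e^x - 1 - x) + e^x (cos y - 1) and
    e^x sin y - y = (e^x - 1) sin y + (sin y - y). Each of the four is at most
    |w|^2 e^|w|, whence the constant 4. *)
Lemma cmod_cexp_sub_affine_le (R : realType) (w : R[i]) :
  cmod (cexp w - 1 - w) <= 4 * (cmod w ^+ 2 * expR (cmod w)).
Proof.
pose r := cmod w; pose x := complex.Re w; pose y := complex.Im w.
have ReE : complex.Re (cexp w - 1 - w) = expR x * cos y - 1 - x.
  by rewrite /x /y; case: (w) => a b /=; rewrite mul0r subr0.
have ImE : complex.Im (cexp w - 1 - w) = expR x * sin y - y.
  by rewrite /x /y; case: (w) => a b /=; rewrite mul0r addr0 oppr0 addr0.
have r0 : 0 <= r by exact: cmod_ge0.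
have xr : `|x| <= r by exact: norm_Re_le_cmod.
have yr : `|y| <= r by exact: norm_Im_le_cmod.
have sq (u : R) : `|u| <= r -> `|u| ^+ 2 <= r ^+ 2.
  by move=> ur; rewrite lerXn2r ?nnegrE.
have ex : expR `|x| <= expR r by rewrite ler_expR.
have ex' : expR x <= expR r by rewrite ler_expR (le_trans (ler_norm x)).
have er1 : 1 <= expR r by rewrite -expR0 ler_expR.
have Re_le : `|expR x * cos y - 1 - x| <= 2 * (r ^+ 2 * expR r).
  rewrite (_ : _ - x = (expR x - 1 - x) + expR x * (cos y - 1)); last by ring.
  rewrite (le_trans (ler_normD _ _))// mulr_natl mulr2n lerD//.
    rewrite mulrC (le_trans (norm_expR_sub_affine_le x))//.
    by rewrite ler_pM ?expR_ge0 ?sqr_ge0 ?sq.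
  rewrite normrM (ger0_norm (expR_ge0 x)) mulrC ler_pM ?expR_ge0//.
  by rewrite (le_trans (norm_cos_sub1_le y))// sq.
have Im_le : `|expR x * sin y - y| <= 2 * (r ^+ 2 * expR r).
  rewrite (_ : _ - y = (expR x - 1) * sin y + (sin y - y)); last by ring.
  rewrite (le_trans (ler_normD _ _))// mulr_natl mulr2n lerD//.
    rewrite (_ : r ^+ 2 * expR r = (expR r * r) * r); last by ring.
    rewrite normrM ler_pM//; last by rewrite (le_trans (norm_sin_le y)).
    rewrite (le_trans (norm_expR_sub1_le x))//.
    by rewrite ler_pM ?expR_ge0.
  rewrite (le_trans (norm_sin_sub_le y))// -[leLHS]mulr1.
  by rewrite ler_pM ?sqr_ge0 ?sq.
apply: le_trans (cmod_le_ReIm _) _.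
rewrite ReE ImE -/r; lra.
Qed.

(** * Complex differentiability of the Laplace transform *)

(** Dividing the remainder by h bounds the distance of the difference quotient
    to D by C |h|. *)
Lemma derivable_quadratic_remainder (R : realType) (f : R[i] -> R[i])
    (z D : R[i]) (C : R) : 0 <= C ->
  (forall h, cmod h <= 1 ->
     cmod (f (z + h) - f z - h * D) <= C * cmod h ^+ 2) ->
  derivable (f : R[i]^o -> R[i]^o) z 1.
Proof.
move=> C0 rem; apply/cvg_ex; exists D; apply/cvgrPdist_le => e e0.
(* The positive elements of R[i] are the positive reals. *)
have [eIm eRe] : complex.Im e = 0 /\ 0 < complex.Re e.
  by move: e0; rewrite ltcE => /andP[/eqP].
have eE : e = (complex.Re e)%:C by rewrite [LHS]complexE eIm mulr0 addr0.
(* C + 1 rather than C, as C may vanish. *)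
pose d : R := Num.min 1 (complex.Re e / (C + 1)).
have C1 : 0 < C + 1 by rewrite ltr_wpDl.
have d0 : 0 < d by rewrite lt_min ltr01 divr_gt0.
have dC0 : 0 < d%:C :> R[i] by rewrite ltcR.
near=> h.
have h0 : h != 0 by near: h; exact: nbhs_dnbhs_neq.
have : `|h| <= d%:C by near: h; exact: dnbhs0_le.
rewrite {1}/Num.norm/= lecR -/(cmod h) le_min => /andP[h1 hd].
have hpos : 0 < cmod h by move: h0; rewrite -normr_gt0 ltcR.
rewrite [in leRHS]eE.
rewrite /Num.norm/= lecR -/(cmod _) /=.
rewrite (_ : _ - _ = - h^-1 * (f (z + h) - f z - h * D)); last first.
  transitivity (D - h^-1 * (f (h + z) - f z) : R[i]).
    by rewrite [h *: 1]mulr1.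
  by rewrite [z + h]addrC; field.
rewrite /cmod ComplexField.Normc.normcM normcN ComplexField.Normc.normcV.
rewrite -/(cmod _).
rewrite mulrC ler_pdivrMr//; apply: le_trans (rem _ h1) _.
rewrite expr2 mulrA ler_wpM2r ?cmod_ge0//.
apply: le_trans (ler_wpM2l C0 hd) _; rewrite mulrA ler_pdivrMr//.
by rewrite mulrC ler_wpM2l// ?lerDl// ltW.
Unshelve. all: by end_near.
Qed.

Lemma exp_moment_integrable (R : realType) (phi : R -> R[i]) (s : R) :
  cL1 phi -> finite_exp_moments phi -> 0 < s ->
  (@lebesgue_measure R).-integrable setT
    (fun t => (expR (`|t| * s) * cmod (phi t))%:E).
Proof.
move=> phi1 moments s0; apply/integrableP; split.
  by apply: measurable_expR_weight; exact: measurable_cmod.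
under eq_integral => t _.
  rewrite gee0_abs; last by rewrite lee_fin mulr_ge0 ?expR_ge0 ?cmod_ge0.
  over.
exact: moments.
Qed.

Lemma cmeasurable_laplace_kernel (R : realType) (phi : R -> R[i]) (z : R[i]) :
  cmeasurable phi -> cmeasurable (laplace_kernel phi z).
Proof.
move=> mphi; apply: cmeasurableM => //.
apply: cmeasurable_cexp; apply: cmeasurableM; last exact: cmeasurable_real.
exact: cmeasurable_cst.
Qed.

Lemma cmod_laplace_kernel_le (R : realType) (phi : R -> R[i]) (z : R[i])
    (t : R) :
  cmod (laplace_kernel phi z t) <= expR (`|t| * cmod z) * cmod (phi t).
Proof.
rewrite cmodM ler_wpM2r ?cmod_ge0// cmod_cexp ler_expR.
apply: le_trans (ler_norm _) _; apply: le_trans (norm_Re_le_cmod _) _.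
by rewrite cmodM cmod_real mulrC.
Qed.

Lemma cL1_laplace_kernel (R : realType) (phi : R -> R[i]) (z : R[i]) :
  cL1 phi -> finite_exp_moments phi -> cL1 (laplace_kernel phi z).
Proof.
move=> phi1 moments; have z0 := cmod_ge0 z.
apply: (@cL1_dominated _ _
  (fun t => expR (`|t| * (cmod z + 1)) * cmod (phi t))).
- exact/cmeasurable_laplace_kernel/cL1_measurable.
- by apply: exp_moment_integrable => //; rewrite ltr_wpDl.
- move=> t; apply: le_trans (cmod_laplace_kernel_le phi z t) _.
  by rewrite ler_wpM2r ?cmod_ge0// ler_expR ler_wpM2l// lerDl.
Qed.

(** The extra factor |t| is at most e^|t|, so it costs one unit of exponent. *)
Lemma cL1_laplace_kernel_derivative (R : realType) (phi : R -> R[i])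
    (z : R[i]) : cL1 phi -> finite_exp_moments phi ->
  cL1 (fun t => t%:C * laplace_kernel phi z t).
Proof.
move=> phi1 moments; have z0 := cmod_ge0 z.
apply: (@cL1_dominated _ _
  (fun t => expR (`|t| * (cmod z + 1)) * cmod (phi t))).
- apply: cmeasurableM; first exact: cmeasurable_real.
  exact/cmeasurable_laplace_kernel/cL1_measurable.
- by apply: exp_moment_integrable => //; rewrite ltr_wpDl.
- move=> t; rewrite cmodM cmod_real mulrDr mulr1 expRD.
  rewrite (mulrC (expR _)) -mulrA.
  by rewrite ler_pM ?cmod_ge0 ?norm_le_expR// cmod_laplace_kernel_le.
Qed.

(** The kernel at z + h is e^(ht) times the kernel at z. The 3 in the exponent
    collects |t|^2 <= e^(2|t|) and e^|ht| <= e^|t|. *)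
Lemma laplace_kernel_remainder_le (R : realType) (phi : R -> R[i])
    (z h : R[i]) (t : R) : cmod h <= 1 ->
  cmod (laplace_kernel phi (z + h) t - laplace_kernel phi z t
        - h * (t%:C * laplace_kernel phi z t))
  <= 4 * cmod h ^+ 2 * (expR (`|t| * (cmod z + 3)) * cmod (phi t)).
Proof.
move=> h1.
rewrite (_ : _ - _ =
    (cexp (h * t%:C) - 1 - h * t%:C) * laplace_kernel phi z t); last first.
  by rewrite /laplace_kernel mulrDl cexpD; ring.
rewrite cmodM.
apply: le_trans (ler_pM (cmod_ge0 _) (cmod_ge0 _)
  (cmod_cexp_sub_affine_le _) (cmod_laplace_kernel_le phi z t)) _.
rewrite cmodM cmod_real.
have t2 : `|t| ^+ 2 <= expR (`|t| * 2).
  by rewrite expRM_natr lerXn2r ?nnegrE ?expR_ge0 ?norm_le_expR.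
have th : expR (cmod h * `|t|) <= expR `|t| by rewrite ler_expR ler_piMl.
rewrite (_ : `|t| * (cmod z + 3) = `|t| * 2 + `|t| + `|t| * cmod z);
  last by ring.
rewrite !expRD.
set A := expR (`|t| * cmod z).
rewrite [leLHS](_ : _ = 4 * cmod h ^+ 2 * (A * cmod (phi t)) *
  (`|t| ^+ 2 * expR (cmod h * `|t|))); last by ring.
rewrite [leRHS](_ : _ = 4 * cmod h ^+ 2 * (A * cmod (phi t)) *
  (expR (`|t| * 2) * expR `|t|)); last by ring.
apply: ler_wpM2l; last by apply: ler_pM; rewrite ?sqr_ge0 ?expR_ge0.
by rewrite !mulr_ge0 ?expR_ge0 ?cmod_ge0.
Qed.

Lemma laplace_entire (R : realType) (phi : R -> R[i]) :
  cL1 phi -> finite_exp_moments phi -> entire (laplace phi).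
Proof.
move=> phi1 moments z; have z0 := cmod_ge0 z.
have K w := cL1_laplace_kernel w phi1 moments.
have DK := cL1_laplace_kernel_derivative z phi1 moments.
have s0 : 0 < cmod z + 3 by rewrite ltr_wpDl.
have gi := exp_moment_integrable phi1 moments s0.
pose G := Rintegral (@lebesgue_measure R) setT
  (fun t => expR (`|t| * (cmod z + 3)) * cmod (phi t)).
apply: (@derivable_quadratic_remainder _ _ z
  (cintegral (fun t => t%:C * laplace_kernel phi z t)) (2 * 4 * G)).
  rewrite mulr_ge0// Rintegral_ge0// => t _.
  by rewrite mulr_ge0 ?expR_ge0 ?cmod_ge0.
move=> h h1; rewrite /laplace -cintegralZ// -!cintegralB//; last 2 first.
- exact: cL1B.
- exact: cL1Z.
rewrite (_ : _ * _ = 2 * ((4 * cmod h ^+ 2) * G)); last by ring.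
rewrite -RintegralZl//.
apply: cmod_cintegral_le => [||t].
- by apply: cL1B; [exact: cL1B|exact: cL1Z].
- exact: (integrableZl measurableT (4 * cmod h ^+ 2) gi).
- exact: laplace_kernel_remainder_le.
Qed.

Unset Implicit Arguments.

Theorem lemma4 (R : realType) (phi : R -> R[i]) (phi_L1 : cL1 phi) :
  ((forall s : R, 0 < s ->
      (\int[@lebesgue_measure R]_t (expR (`|t| * s) * cmod (phi t))%:E
         < +oo)%E)
   <->
   (tail_exponent phi s / s%:E)%E @[s --> +oo] --> +oo%E)
  /\
  ((forall s : R, 0 < s ->
      (\int[@lebesgue_measure R]_t (expR (`|t| * s) * cmod (phi t))%:E
         < +oo)%E) ->
   (forall z : R[i], cL1 (laplace_kernel phi z)) /\ entire (laplace phi)).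
Proof.
split; first exact: finite_exp_moments_iff.
move=> moments; split; last exact: laplace_entire.
by move=> z; exact: cL1_laplace_kernel.
Qed.
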